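(* Define an infinite triangular array $\tau$ by $\tau_{n,j}=\mathcal T_{n+3,j+3}$ for every $n\ge 0$ and $1\le j\le n+1$. Then for every $n\ge 2$, the sequence $\tau_{n,*}=[\tau_{n,1},\dots,\tau_{n,n+1}]$ is strictly positive and log-concave.
   Context: Define $\psi:\{1,2,3,\dots\}\to\{0,1,2,\dots\}$ by $\psi(1)=0$, $\psi(2)=1$, $\psi(3)=2$ and $\psi(j)=\sum_{k=1}^{j-1}\psi(k)$ for $j\ge 4$. The triangular array $\mathcal T=(\mathcal T_{n,j})$, $n\ge 0$, $1\le j\le n+1$, of integers is defined recursively by: $\mathcal T_{n,n+1}=1$ for every $n\ge 0$; $\mathcal T_{1,1}=1$, $\mathcal T_{2,2}=2$, $\mathcal T_{3,3}=3$; $\mathcal T_{n,n}=\sum_{k=1}^{n-2}\mathcal T_{n-k,n-k}$ for every $n\ge 4$; and $\mathcal T_{n,j}=\mathcal T_{n-1,j}+\psi(j)$ for every $n\ge 2$ and $1\le j\le n-1$. A finite sequence $[\eta_1,\dots,\eta_{n+1}]$ ($n\ge2$) of real numbers is log-concave if $\eta_{i-1}\eta_{i+1}\le\eta_i^2$ for all $2\le i\le n$. *)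

(* Defs.v *)
From mathcomp Require Import all_boot all_order all_algebra.

Set Implicit Arguments.
Unset Strict Implicit.
Unset Printing Implicit Defensive.

Import Order.TTheory GRing.Theory Num.Theory.
Local Open Scope ring_scope.

(* Course-of-values recursion: F receives the list of all earlier values, so   *)
(* cov F n = F [:: cov F 0; ...; cov F n.-1], see covE.                        *)
Definition cov (A : Type) (F : seq A -> A) (n : nat) : A :=
  F (iter n (fun s => rcons s (F s)) [::]).

Lemma covE (A : Type) (F : seq A -> A) (n : nat) :
  cov F n = F (mkseq (cov F) n).
Proof.
rewrite /cov; congr F; elim: n => //= n IHn.
rewrite {1 2}IHn /mkseq -[in RHS]addn1 iotaD map_cat /= add0n cats1.
by rewrite IHn.
Qed.

(* The value at 0 is junk. *)
Definition psi : nat -> nat :=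
  cov (fun s => match size s with
                | 0 => 0
                | 1 => 0
                | 2 => 1
                | 3 => 2
                | j => \sum_(1 <= k < j) nth 0 s k
                end)%N.

Lemma psi1 : psi 1 = 0%N. Proof. by []. Qed.
Lemma psi2 : psi 2 = 1%N. Proof. by []. Qed.
Lemma psi3 : psi 3 = 2%N. Proof. by []. Qed.

Lemma psi_rec (j : nat) :
  (4 <= j)%N -> psi j = (\sum_(1 <= k < j) psi k)%N.
Proof.
case: j => [|[|[|[|j]]]] // _; rewrite {1}/psi covE size_mkseq.
by apply: eq_big_nat => k /andP[_ kj]; rewrite nth_mkseq.
Qed.

(* The diagonal T_{n,n} for n >= 1, whose recursion involves only itself; the  *)
(* value at 0 is junk.                                                         *)
Definition diagT : nat -> int :=
  cov (fun s : seq int => match size s with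
                | 0 => 0
                | 1 => 1
                | 2 => 2
                | 3 => 3
                | n => \sum_(1 <= k < n.-1) nth 0 s (n - k)
                end).

(* Meaningful for 1 <= j <= n + 1 only; all values outside are junk. The        *)
(* defining relations of the array are the lemmas that follow.                 *)
Fixpoint T (n j : nat) : int :=
  if j == n.+1 then 1
  else if j == n then diagT n
  else if n is m.+1 then T m j + (psi j)%:Z
  else 0.

Lemma TE (n j : nat) :
  T n j = if j == n.+1 then 1
          else if j == n then diagT n
          else if n is m.+1 then T m j + (psi j)%:Z
          else 0.
Proof. by case: n. Qed.

Lemma T_last (n : nat) : T n n.+1 = 1.
Proof. by rewrite TE eqxx. Qed.

Lemma T_diag (n : nat) : T n n = diagT n.
Proof. by rewrite TE ltn_eqF // eqxx. Qed.

Lemma T11 : T 1 1 = 1. Proof. by []. Qed.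
Lemma T22 : T 2 2 = 2. Proof. by []. Qed.
Lemma T33 : T 3 3 = 3. Proof. by []. Qed.

Lemma T_diag_rec (n : nat) :
  (4 <= n)%N -> T n n = \sum_(1 <= k < n.-1) T (n - k) (n - k).
Proof.
rewrite T_diag; case: n => [|[|[|[|n]]]] // _.
rewrite {1}/diagT covE size_mkseq.
apply: eq_big_nat => k /andP[k0 _]; rewrite T_diag nth_mkseq //.
by rewrite ltn_subrL k0.
Qed.

Lemma T_step (n j : nat) :
  (2 <= n)%N -> (1 <= j <= n.-1)%N -> T n j = T n.-1 j + (psi j)%:Z.
Proof.
case: n => // n _ /= /andP[_ jn].
by rewrite TE (ltn_eqF (leqW jn : j < n.+2)%N) (ltn_eqF (jn : j < n.+1)%N).
Qed.

Definition tau (n j : nat) : int := T (n + 3) (j + 3).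

(* A finite sequence [eta_1, ..., eta_{n+1}] is represented by its length       *)
(* parameter n and a function eta, of which only eta 1, ..., eta n.+1 are used. *)
Definition strictly_positive (R : realDomainType) (n : nat) (eta : nat -> R) :=
  forall i : nat, (1 <= i <= n.+1)%N -> 0 < eta i.

Definition log_concave (R : realDomainType) (n : nat) (eta : nat -> R) :=
  forall i : nat, (2 <= i <= n)%N -> eta i.-1 * eta i.+1 <= eta i ^+ 2.

(* Main.v *)
Require Import Defs.
From mathcomp Require Import all_boot all_order all_algebra.
From mathcomp Require Import zify ring.

(** From index 4 on, each value of [psi] is the sum of all the previous ones, so
    it doubles at each step; the same holds for the diagonal of the array, up to
    the omission of its first term. Hence psi (j + 4) = 3 * 2 ^ j and
    T (j + 4) (j + 4) = 5 * 2 ^ j. A column grows arithmetically below the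
    diagonal, with increment psi, so that, writing n = j + d,
      tau n j = 2 ^ (j - 1) * (5 + 3 * d)   for 1 <= j <= n,
      tau n (n + 1) = 1   ([tau_closed], [tau_last]).
    Positivity is then visible. Along the row n the formula for j <= n is a
    geometric sequence times a positive arithmetic one, and both are log-concave:
    with a = 5 + 3 * d the inequality is (a + 3) * (a - 3) <= a ^ 2. The final 1
    does not follow this pattern, and the inequality centred at n is numerical:
    8 * 2 ^ (n - 2) <= (5 * 2 ^ (n - 1)) ^ 2. *)

Set Implicit Arguments.
Unset Strict Implicit.
Unset Printing Implicit Defensive.

Import Order.TTheory GRing.Theory Num.Theory.
Local Open Scope ring_scope.

Local Arguments T : simpl never.

Lemma psi_closed (j : nat) : psi j.+4 = (3 * 2 ^ j)%N.
Proof.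
elim: j => [|j IHj].
  by rewrite psi_rec // unlock.
rewrite psi_rec // big_nat_recr //= -psi_rec // IHj expnS; lia.
Qed.

Lemma T_diag_closed (j : nat) : T j.+4 j.+4 = 5 * 2 ^+ j.
Proof.
elim: j => [|j IHj]; first by rewrite T_diag_rec // unlock.
(* Without its first term, the sum for T_(n+1,n+1) is the one for T_(n,n). *)
rewrite T_diag_rec // big_ltn // big_add1 /= subSS subn0.
under eq_bigr => k _ do rewrite subSS.
rewrite -(T_diag_rec (n := j.+4)) // IHj exprS; ring.
Qed.

Lemma T_column (j d : nat) :
  (0 < j)%N -> T (j + d) j = T j j + d%:Z * (psi j)%:Z.
Proof.
move=> j0; elim: d => [|d IHd]; first by rewrite addn0 mul0r addr0.
rewrite addnS T_step; [|lia|lia].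
rewrite /= IHd intS; ring.
Qed.

(** The shift by 3 puts all the columns of [tau] in the range where [psi] and the
    diagonal are exactly geometric with the same ratio, so that the power of 2
    factors out of the arithmetic progression along the column. *)
Lemma tau_closed (j d : nat) :
  tau (j.+1 + d) j.+1 = 2 ^+ j * (5 + 3 * d%:Z).
Proof.
rewrite /tau addnAC T_column ?addn3 // T_diag_closed psi_closed PoszM.
rewrite -[Posz (2 ^ j)]natz natrX; ring.
Qed.

Lemma tau_last (n : nat) : tau n n.+1 = 1.
Proof. by rewrite /tau addSn T_last. Qed.

Lemma tau_gt0 (n : nat) : strictly_positive n (tau n).
Proof.
case=> // j /andP[_]; rewrite ltnS leq_eqVlt => /predU1P[->|jn].
  by rewrite tau_last.
rewrite -(subnKC jn) tau_closed mulr_gt0 ?exprn_gt0 //; lia.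
Qed.

Lemma tau_log_concave (n : nat) : log_concave n (tau n).
Proof.
case=> [|[|i]] // /andP[_ iltn]; rewrite /=.
rewrite -(subnKC iltn); case: (n - i.+2)%N => [|d].
  (* Centre n: the right neighbour is the final 1. *)
  rewrite addn0 tau_last.
  have := tau_closed i 1; rewrite addn1 => ->.
  have := tau_closed i.+1 0; rewrite addn0 => ->.
  have : 1 <= 2 ^+ i :> int by rewrite exprn_ege1.
  rewrite (exprS 2); move: (2 ^+ i) => x x1.
  have -> : (2 * x * (5 + 3 * 0%:Z)) ^+ 2 = 100 * (x * x) by ring.
  nia.
have := tau_closed i d.+2; rewrite -addSnnS => ->.
rewrite tau_closed -addSnnS tau_closed !(exprS 2) !intS.
move: (2 ^+ i) => x; rewrite -subr_ge0.
(* With a = 5 + 3 * (d + 1), the gap is (2 * x) ^ 2 times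
   a ^ 2 - (a + 3) * (a - 3) = 9. *)
have -> : (2 * x * (5 + 3 * (1 + d%:Z))) ^+ 2
    - x * (5 + 3 * (1 + (1 + d%:Z))) * (2 * (2 * x) * (5 + 3 * d%:Z))
  = (6 * x) ^+ 2 by ring.
exact: sqr_ge0.
Qed.

Theorem lemma2p2 (n : nat) (hn : (2 <= n)%N) :
  strictly_positive n (tau n) /\ log_concave n (tau n).
Proof. by split; [exact: tau_gt0 | exact: tau_log_concave]. Qed.
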